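(* Let $\zeta$ be a real random variable with finite mathematical expectation and cumulative distribution function $F$, and let $p=P\{\zeta>0\}=1-F(0)$ with $0<p<1$, $E^-=\big|\mathrm{E}(\zeta\mid\zeta\le 0)\big|$, $E^+=\mathrm{E}(\zeta\mid\zeta>0)$. Let $n$ be a positive integer, $n_0\in\{1,\ldots,n-1\}$, and let $\boldsymbol\eta=(\eta_1,\ldots,\eta_n)$ be a voting sample of size $n$ from the distribution of $\zeta$ with absolute voting threshold $n_0$. Then for every $k=1,\ldots,n$, $$\mathrm{E}(\eta_k)=p\,(E^+ + E^-)\,B(p\mid n_0,\,n-n_0)-E^-\,B(p\mid n_0+1,\,n-n_0).$$
   Context: A voting sample of size $n$ with absolute voting threshold $n_0$ from the distribution of $\zeta$ is the random vector $(\zeta_1 I(\boldsymbol\zeta,n_0),\ldots,\zeta_n I(\boldsymbol\zeta,n_0))$, where $\boldsymbol\zeta=(\zeta_1,\ldots,\zeta_n)$ is a vector of independent copies of $\zeta$, and $I(\boldsymbol\zeta,n_0)=1$ if $\#\{k:\zeta_k>0,\ k=1,\ldots,n\}>n_0$, and $I(\boldsymbol\zeta,n_0)=0$ otherwise. $B(\cdot\mid m,l)$ denotes the cumulative distribution function of the Beta distribution with parameters $m$ and $l$, i.e. $B(x\mid m,l)=\int_0^x t^{m-1}(1-t)^{l-1}\,dt\Big/\int_0^1 t^{m-1}(1-t)^{l-1}\,dt$ for $0\le x\le1$. *)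

(* Defs.v *)
From HB Require Import structures.
From mathcomp Require Import all_boot all_order all_algebra.
From mathcomp Require Import all_classical all_reals all_analysis.

Set Implicit Arguments.
Unset Strict Implicit.
Unset Printing Implicit Defensive.

Import Order.TTheory GRing.Theory Num.Theory.
Import numFieldNormedType.Exports.

Local Open Scope classical_set_scope.
Local Open Scope ring_scope.

(* The product rule over every subfamily J, on Borel sets. *)
Definition mutually_independent d (T : measurableType d) (R : realType)
    (P : probability T R) (I : finType) (X : I -> {RV P >-> R}) : Prop :=
  forall (J : {set I}) (A : I -> set R), (forall i, measurable (A i)) ->
    P (\bigcap_(i in [set` J]) (X i @^-1` A i)) =
    (\prod_(i in J) P (X i @^-1` A i))%E.

(* The two variables may live on different probability spaces; laws are only
   compared on Borel sets, since [distribution] has junk values elsewhere. *)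
Definition same_distribution d (T : measurableType d) d' (T' : measurableType d')
    (R : realType) (P : probability T R) (P' : probability T' R)
    (X : {RV P >-> R}) (Y : {RV P' >-> R}) : Prop :=
  forall A : set R, measurable A -> distribution P X A = distribution P' Y A.

Definition independent_copies d (T : measurableType d) d'
    (T' : measurableType d') (R : realType) (P : probability T R)
    (P' : probability T' R) (zeta : {RV P >-> R}) (n : nat)
    (Z : 'I_n -> {RV P' >-> R}) : Prop :=
  mutually_independent Z /\ (forall i, same_distribution zeta (Z i)).

Definition voting_indicator (R : realType) (n : nat) (z : 'I_n -> R)
    (n0 : nat) : R :=
  (n0 < #|[pred k : 'I_n | (0 < z k)%R]|)%N%:R.

Definition voting_sample d (T : measurableType d) d' (T' : measurableType d')
    (R : realType) (P : probability T R) (P' : probability T' R)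
    (zeta : {RV P >-> R}) (n n0 : nat) (eta : 'I_n -> T' -> R) : Prop :=
  exists2 Z : 'I_n -> {RV P' >-> R}, independent_copies zeta Z &
    forall k w, eta k w = Z k w * voting_indicator (fun i => Z i w) n0.

(* The elementary conditional expectation E(X | A), for an event A of
   positive probability. *)
Definition cond_expectation d (T : measurableType d) (R : realType)
    (P : probability T R) (X : {RV P >-> R}) (A : set T) : R :=
  (\int[P]_(w in A) X w) / fine (P A).

(* B(x | m, l) for 0 <= x <= 1 and integers m, l >= 1 (the predecessors are
   truncated at 0). *)
Definition beta_cdf (R : realType) (m l : nat) (x : R) : R :=
  (\int[lebesgue_measure]_(t in `[0, x]) (t ^+ m.-1 * (1 - t) ^+ l.-1)) /
  (\int[lebesgue_measure]_(t in `[0, 1]) (t ^+ m.-1 * (1 - t) ^+ l.-1)).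

Lemma prob_gt0_cdf d (T : measurableType d) (R : realType)
    (P : probability T R) (zeta : {RV P >-> R}) :
  fine (P [set w | 0 < zeta w]) = 1 - fine (cdf zeta 0).
Proof.
have -> : P [set w | 0 < zeta w] = ccdf zeta 0.
  by congr (P _); apply/seteqP; split=> w /=; rewrite in_itv/= andbT.
have cfin : cdf zeta 0 \is a fin_num by exact: fin_num_measure.
by rewrite ccdf_1_cdf -(fineK cfin).
Qed.

(* Main.v *)
Require Import Defs.
From HB Require Import structures.
From mathcomp Require Import all_boot all_order all_algebra.
From mathcomp Require Import all_classical all_reals all_analysis.
From mathcomp Require Import measurable_realfun.
From mathcomp Require Import ring zify.
Import Order.TTheory GRing.Theory Num.Theory.
Import numFieldNormedType.Exports.
Local Open Scope classical_set_scope.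
Local Open Scope ring_scope.

(** The sample space splits according to the set S of indices at which the
    independent copies Z_i of zeta are positive. On the piece of S the vote
    passes exactly when S has more than n0 elements
    ([voting_sum_sign_patterns]), and the piece is an intersection of one event
    per variable. Independence and equality of laws therefore give the integral
    of Z_k over it as the product of the probabilities of the signs of the other
    variables and of the integral of zeta over the event that it has the sign
    prescribed at k ([integral_rectangle]), that is

      p^|S| (1 - p)^(n - |S|) E^+     if k is in S,
    - p^|S| (1 - p)^(n - |S|) E^-     otherwise.

    In both cases this is the common term with - E^-, to which the sets S
    containing k add the same weight times E^+ + E^-. Summing over S with more
    than n0 elements, the first part yields the probability of more than n0
    successes among n trials, the second yields p times the probability of at
    least n0 successes among the n - 1 trials other than k
    ([sum_sign_patterns_binomial_tail]).

    It remains to recognise these binomial tails as values of Beta distribution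
    functions ([beta_cdf_binomial_tail]). As polynomials in p, they vanish at 0,
    equal 1 at 1, and have a derivative proportional to the Beta density,
    because the differentiated sum telescopes ([deriv_binomial_tail]). *)

Set Implicit Arguments.
Unset Strict Implicit.

(** * Binomial tails and the Beta distribution *)

(** The probability that a binomial variable with N trials is at least j, as a
    polynomial in the success probability, so that it can be differentiated
    formally. *)
Definition binomial_tail (R : realType) (N j : nat) : {poly R} :=
  \sum_(j <= s < N.+1) 'X^s * (1 - 'X) ^+ (N - s) *+ 'C(N, s).

(** The product rule splits the derivative of each summand into a difference of
    consecutive terms, so the sum telescopes; the term past the end vanishes and
    only the one at j survives. *)
Lemma deriv_binomial_tail (R : realType) (N j : nat) :
  (0 < j <= N)%N ->
  (binomial_tail R N j)^`() =
  'X^(j.-1) * (1 - 'X) ^+ (N - j) *+ (N * 'C(N.-1, j.-1)).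
Proof.
move=> /andP[j0 jN]; rewrite /binomial_tail raddf_sum /=.
(* The derivative of the s-th summand is U s - U s.+1. *)
pose U s : {poly R} := 'X^(s.-1) * (1 - 'X) ^+ (N - s) *+ (N * 'C(N.-1, s.-1)).
rewrite -[RHS]/(U j).
have UN : U N.+1 = 0.
  by rewrite /U bin_small ?muln0 ?mulr0n// ltn_predL (leq_trans j0).
have -> : U j = \sum_(j <= s < N.+1) (U s - U s.+1).
  rewrite -[LHS]subr0 -{1}UN -opprB -(telescope_sumr U (leqW jN)) -sumrN.
  by apply: eq_bigr => s _; rewrite opprB.
rewrite [LHS]big_nat [RHS]big_nat.
apply: eq_bigr => -[|s] /andP[js sN]; first by move: (leq_trans j0 js).
rewrite /U /= derivMn derivM derivXn !deriv_exp derivB derivX.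
rewrite -[1]/(1%:P) derivC sub0r.
move: sN; rewrite ltnS leq_eqVlt => /predU1P[E|sN].
  rewrite -E subnn expr0 mulr0n !mulr0 addr0 !mulr1 !binn /=.
  by rewrite bin_small// muln0 mulr0n subr0 muln1 mulr1n.
pose M := (N - s.+2)%N.
have EN : N = (s.+2 + M)%N by rewrite subnKC.
have -> : (N - s.+1)%N = M.+1 by lia.
rewrite -/M /=.
(* Absorption identities for binomial coefficients: both coefficients of U are
   multiples of that of the differentiated summand. *)
have E1 : (N * 'C(N.-1, s) = s.+1 * 'C(N, s.+1))%N.
  by rewrite EN /= mul_bin_diag.
have E2 : (N * 'C(N.-1, s.+1) = M.+1 * 'C(N, s.+1))%N.
  rewrite {1 2}EN [(_ + M).-1]/= mul_bin_diag mul_bin_left -EN.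
  by congr muln; lia.
rewrite {}E1 {}E2 mulrnDl mulN1r mulNrn mulrN mulNrn.
by rewrite mulrnAl mulrnAr -!mulrnA.
Qed.

Lemma Rintegral_deriv_horner (R : realType) (F : {poly R}) (a b : R) :
  a < b ->
  \int[lebesgue_measure]_(t in `[a, b]) F^`().[t] = F.[b] - F.[a].
Proof.
move=> ab; rewrite /Rintegral (@continuous_FTC2 _ _ (horner F))//.
- exact/continuous_subspaceT/continuous_horner.
- split=> [x _||]; first exact: derivable_horner.
  + exact/cvg_at_right_filter/continuous_horner.
  + exact/cvg_at_left_filter/continuous_horner.
- by move=> x _; rewrite derivE.
Qed.

Lemma binomial_tail0 (R : realType) (N j : nat) :
  (0 < j)%N -> (binomial_tail R N j).[0] = 0.
Proof.
move=> j0; rewrite horner_sum big_nat big1// => s /andP[js _].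
rewrite hornerMn !hornerE expr0n -leqn0 leqNgt (leq_trans j0 js).
by rewrite mul0r mul0rn.
Qed.

Lemma binomial_tail1 (R : realType) (N j : nat) :
  (j <= N)%N -> (binomial_tail R N j).[1] = 1.
Proof.
move=> jN; rewrite horner_sum big_nat_recr//= big_nat big1 => [|s /andP[_ sN]].
  by rewrite subnn binn hornerMn !hornerE expr1n.
rewrite hornerMn !hornerE subrr [in X in _ * X]expr0n subn_eq0 leqNgt sN.
by rewrite mulr0 mul0rn.
Qed.

(** Up to a constant factor the binomial tail is a primitive of the Beta density
    that vanishes at 0. The factor cancels in the quotient defining [beta_cdf],
    whose denominator is the same primitive taken at 1, where the tail is 1; the
    value of the Beta integral is thus never computed. *)
Lemma beta_cdf_binomial_tail (R : realType) (m l : nat) (x : R) :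
  (0 < m)%N -> (0 < l)%N -> 0 < x ->
  beta_cdf m l x = (binomial_tail R (m + l).-1 m).[x].
Proof.
move=> m0 l0 x0; set N := (m + l).-1.
have mN : (0 < m <= N)%N by rewrite m0 /N; lia.
pose c : R := (N * 'C(N.-1, m.-1))%:R.
have c0 : c != 0.
  by rewrite pnatr_eq0 -lt0n muln_gt0 bin_gt0; lia.
have tailE (y : R) : 0 < y ->
    \int[lebesgue_measure]_(t in `[0, y]) (t ^+ m.-1 * (1 - t) ^+ l.-1) =
    c^-1 * (binomial_tail R N m).[y].
  move=> y0; have -> : (fun t : R => t ^+ m.-1 * (1 - t) ^+ l.-1) =
      horner (c^-1 *: binomial_tail R N m)^`().
    apply/funext => t; rewrite derivZ deriv_binomial_tail//.
    rewrite hornerZ hornerMn !hornerE.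
    have -> : (N - m = l.-1)%N by rewrite /N; lia.
    by rewrite -mulr_natr -/c [RHS]mulrC mulfK.
  rewrite Rintegral_deriv_horner// !hornerE binomial_tail0// mulr0 subr0//.
rewrite /beta_cdf !tailE// binomial_tail1; last by case/andP: mN.
by rewrite mulr1 invrK mulrAC mulVf// mul1r.
Qed.

(** * Sums over subsets *)

Lemma sum_subsets_binomial_tail (R : realType) (I : finType) (A : {set I})
    (j : nat) (x : R) :
  \sum_(S : {set I} | (S \subset A) && (j <= #|S|)%N)
     x ^+ #|S| * (1 - x) ^+ (#|A| - #|S|) =
  (binomial_tail R #|A| j).[x].
Proof.
rewrite (partition_big (fun S : {set I} => inord #|S| : 'I_#|A|.+1)
  (fun s => (j <= s)%N)) /=; last first.
  by move=> S /andP[SA jS]; rewrite inordK// ltnS subset_leq_card.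
rewrite horner_sum big_geq_mkord/=.
apply: eq_bigr => s js.
rewrite (eq_big
  (fun S : {set I} => S \in [set S : {set I} | S \subset A & #|S| == s])
  (fun=> x ^+ s * (1 - x) ^+ (#|A| - s))).
- by rewrite sumr_const cards_draws hornerMn !hornerE.
- move=> S; rewrite inE -andbA; case: (boolP (S \subset A)) => //= SA.
  rewrite -val_eqE/= inordK ?ltnS ?subset_leq_card//.
  by case: eqVneq => [->|]; rewrite ?andbF// andbT js.
- move=> S /andP[/andP[SA _] /eqP <-].
  by rewrite inordK// ltnS subset_leq_card.
Qed.

(** Removing k from S leaves an arbitrary set of at least j of the other n - 1
    indices, and the trial k contributes the factor x. *)
Lemma sum_subsets_containing_binomial_tail (R : realType) (n : nat) (k : 'I_n)
    (j : nat) (x : R) :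
  \sum_(S : {set 'I_n} | (k \in S) && (j < #|S|)%N)
     x ^+ #|S| * (1 - x) ^+ (n - #|S|) =
  x * (binomial_tail R n.-1 j).[x].
Proof.
have cardk : #|~: [set k]| = n.-1 by rewrite cardsC1 card_ord.
rewrite -cardk -sum_subsets_binomial_tail big_distrr/=.
rewrite (reindex_onto (fun S : {set 'I_n} => k |: S) (fun S => S :\ k))/=;
  last first.
  by move=> S /andP[kS _]; rewrite finset.setD1K.
apply: eq_big => S.
  rewrite finset.setU11/= finset.subsetC finset.sub1set inE cardsU1.
  case: (boolP (k \in S)) => kS /=.
    apply/negbTE; rewrite negb_and orbC; apply/orP; left.
    by apply/eqP => /setP /(_ k); rewrite !inE eqxx kS.
  by rewrite add1n ltnS finset.setU1K// eqxx andbT.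
move=> /andP[_ /eqP kS].
have kNS : k \notin S by rewrite -kS !inE eqxx.
rewrite cardsU1 kNS cardk add1n exprS mulrA; congr (_ * _ ^+ _).
by rewrite subnS -subn1 subnAC subn1.
Qed.

(** The integral at the index k is a probability times a conditional mean: it
    supplies the factor missing from the product over the other indices. *)
Lemma prod_sign_pattern (R : realType) (n : nat) (k : 'I_n) (S : {set 'I_n})
    (a b u v : R) :
  \prod_(i < n | i != k) (if i \in S then a else b) *
    (if k \in S then a * u else b * v) =
  a ^+ #|S| * b ^+ (n - #|S|) * (if k \in S then u else v).
Proof.
have -> : a ^+ #|S| * b ^+ (n - #|S|) =
    \prod_(i < n) (if i \in S then a else b).
  have -> : (n - #|S| = #|[predC S]|)%N.
    by rewrite -[X in (X - _)%N]card_ord -(cardC S) addKn.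
  rewrite (bigID [in S])/=; congr (_ * _).
    by rewrite (eq_bigr (fun=> a)) ?prodr_const// => i ->.
  by rewrite (eq_bigr (fun=> b)) ?prodr_const// => i /negbTE ->.
by rewrite [in RHS](bigD1 k)//=; case: (k \in S); ring.
Qed.

(** Writing u as v + (u - v), the first part is summed over all patterns, which
    gives a tail with n trials, and the second over the patterns containing k,
    which gives a tail with n - 1 trials. *)
Lemma sum_sign_patterns_binomial_tail (R : realType) (n n0 : nat) (k : 'I_n)
    (p u v : R) :
  \sum_(S : {set 'I_n} | (n0 < #|S|)%N)
    p ^+ #|S| * (1 - p) ^+ (n - #|S|) * (if k \in S then u else v) =
  p * (u - v) * (binomial_tail R n.-1 n0).[p] +
  v * (binomial_tail R n n0.+1).[p].
Proof.
have -> : binomial_tail R n n0.+1 = binomial_tail R #|[set: 'I_n]%SET| n0.+1.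
  by rewrite cardsT card_ord.
rewrite mulrAC -(sum_subsets_containing_binomial_tail k).
rewrite -sum_subsets_binomial_tail.
rewrite mulr_sumr mulr_suml.
under [X in _ = _ + X]eq_bigl do rewrite finset.subsetT/=.
under [X in _ = X + _]eq_bigl do rewrite andbC.
rewrite big_mkcondr/= -big_split/=; apply: eq_bigr => S _.
by rewrite cardsT card_ord; case: (k \in S); ring.
Qed.

(** * Integration over an independent event *)

Lemma measurable_RV_preimage d (T : measurableType d) (R : realType)
    (P : probability T R) (X : {RV P >-> R}) (D : set R) :
  measurable D -> measurable (X @^-1` D).
Proof. by move=> mD; rewrite -[_ @^-1` _]setTI; exact: measurable_funP. Qed.

Lemma ge0_integral_mrestr d (T : measurableType d) (R : realType)
    (mu : {measure set T -> \bar R}) (E D : set T) (mE : measurable E)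
    (f : T -> \bar R) :
  measurable D -> measurable_fun D f -> (forall x, D x -> 0 <= f x)%E ->
  (\int[mrestr mu mE]_(x in D) f x = \int[mu]_(x in E `&` D) f x)%E.
Proof.
move=> mD mf f0.
(* The complement of E is null for the restricted measure, and on subsets of E
   the two measures agree. *)
rewrite (@ge0_negligible_integral _ _ _ _ D (~` E))//; last 2 first.
- exact: measurableC.
- by rewrite /= /mrestr setICl measure0.
rewrite setDE setCK setIC; apply: eq_measure_integral => A mA AED.
by rewrite /= /mrestr setIidl// => x /AED[].
Qed.

(** Under the law hypothesis, the image by Y of P' restricted to E is P' E times
    the law of X, so the two integrals are integrals over D against the same
    measure on the line. Taking E to be the whole space gives invariance of the
    integral under a change of variable with the same law; taking E independent
    of Y gives the factorisation of an expectation. *)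
Lemma ge0_integral_law d (T : measurableType d) d' (T' : measurableType d')
    (R : realType) (P : probability T R) (P' : probability T' R)
    (X : {RV P >-> R}) (Y : {RV P' >-> R}) (E : set T') (D : set R)
    (f : R -> \bar R) :
  measurable E -> measurable D -> measurable_fun setT f ->
  (forall x, 0 <= f x)%E ->
  (forall B, measurable B -> P' (E `&` Y @^-1` B) = P' E * P (X @^-1` B))%E ->
  (\int[P']_(w in E `&` Y @^-1` D) (f \o Y) w =
   P' E * \int[P]_(w in X @^-1` D) (f \o X) w)%E.
Proof.
move=> mE mD mf f0 EY.
have PE : (P' E = (fine (P' E))%:E)%E by rewrite fineK// fin_num_measure.
have PE0 : 0 <= fine (P' E) by rewrite fine_ge0.
pose c : {nonneg R} := NngNum PE0.
have mfD : measurable_fun D f by exact: measurable_funTS.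
have mYD : measurable (Y @^-1` D) by exact: measurable_RV_preimage.
have mfY : measurable_fun (Y @^-1` D) (f \o Y).
  by apply: measurable_funTS; exact: measurableT_comp.
rewrite -(@ge0_integral_mrestr _ _ _ P' _ _ mE (f \o Y)) //; last first.
  by move=> x _; exact: f0.
rewrite -ge0_integral_pushforward//.
rewrite -[in RHS](@ge0_integral_pushforward _ _ _ _ _ X)//.
rewrite PE -[(fine _)%:E]/(c%:num%:E) -ge0_integral_mscale//.
apply: eq_measure_integral => A mA _.
change (P' (Y @^-1` A `&` E) = c%:num%:E * P (X @^-1` A))%E.
by rewrite setIC EY// [in LHS]PE.
Qed.

Lemma integral_law d (T : measurableType d) d' (T' : measurableType d')
    (R : realType) (P : probability T R) (P' : probability T' R)
    (X : {RV P >-> R}) (Y : {RV P' >-> R}) (E : set T') (D : set R)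
    (f : R -> \bar R) :
  measurable E -> measurable D -> measurable_fun setT f ->
  P.-integrable (X @^-1` D) (f \o X) ->
  (forall B, measurable B -> P' (E `&` Y @^-1` B) = P' E * P (X @^-1` B))%E ->
  (\int[P']_(w in E `&` Y @^-1` D) (f \o Y) w =
   P' E * \int[P]_(w in X @^-1` D) (f \o X) w)%E.
Proof.
move=> mE mD mf fX EY.
have mXD : measurable (X @^-1` D) by exact: measurable_RV_preimage.
rewrite integralE [in RHS]integralE muleBr ?fin_num_measure//; last first.
  rewrite fin_num_adde_defl ?fin_numN //.
  exact: (integrable_neg_fin_num mXD fX).
rewrite (funepos_comp f X) (funeneg_comp f X).
rewrite (funepos_comp f Y) (funeneg_comp f Y).
rewrite -!(@ge0_integral_law _ _ _ _ _ _ _ X Y E D)//.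
- exact: measurable_funeneg.
- exact: measurable_funepos.
Qed.

(** The set B is kept apart from the A i because it has to vary while they are
    fixed: this determines the law of Z k on the event given by the others. *)
Lemma independent_extract d (T : measurableType d) (R : realType)
    (P : probability T R) (I : finType) (Z : I -> {RV P >-> R}) (k : I)
    (A : I -> set R) (B : set R) :
  mutually_independent Z -> (forall i, measurable (A i)) -> measurable B ->
  P (\bigcap_(i in [set i | i != k]) (Z i @^-1` A i) `&` Z k @^-1` B) =
  (\prod_(i | i != k) P (Z i @^-1` A i) * P (Z k @^-1` B))%E.
Proof.
move=> indZ mA mB.
have mC i : measurable (if i == k then B else A i) by case: ifP.
have := indZ [set: I]%SET _ mC; rewrite (bigD1 k) ?finset.in_setT//= eqxx => EC.
have -> : \bigcap_(i in [set i | i != k]) (Z i @^-1` A i) `&` Z k @^-1` B =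
    \bigcap_(i in [set` [set: I]%SET]) (Z i @^-1` (if i == k then B else A i)).
  apply/seteqP; split => [w [wA wB] i _ | w wC].
    by case: eqVneq => [->//|ik]; exact: wA.
  split; last by have := wC k; rewrite eqxx; apply; rewrite /= finset.in_setT.
  move=> i /= ik; have := wC i; rewrite (negbTE ik); apply.
  by rewrite /= finset.in_setT.
rewrite EC muleC; congr (_ * _)%E; apply: eq_big => i.
  by rewrite finset.in_setT.
by move=> /andP[_ /negbTE ->].
Qed.

(** The constraints on the indices other than k form an event independent of
    Z k, so they contribute their probability as a factor. *)
Lemma integral_rectangle d (T : measurableType d) d' (T' : measurableType d')
    (R : realType) (P : probability T R) (P' : probability T' R)
    (zeta : {RV P >-> R}) (n : nat) (Z : 'I_n -> {RV P' >-> R}) (k : 'I_n)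
    (A : 'I_n -> set R) :
  P.-integrable [set: T] (EFin \o zeta) -> independent_copies zeta Z ->
  (forall i, measurable (A i)) ->
  (\int[P']_(w in \bigcap_(i in [set: 'I_n]) (Z i @^-1` A i)) (Z k w)%:E =
   \prod_(i < n | i != k) P (zeta @^-1` A i) *
   \int[P]_(w in zeta @^-1` A k) (zeta w)%:E)%E.
Proof.
move=> izeta [indZ sameZ] mA.
pose E := \bigcap_(i in [set i | i != k]) (Z i @^-1` A i).
have mE : measurable E.
  apply: fin_bigcap_measurable => [|i _]; first exact: finite_finset.
  exact: measurable_RV_preimage.
have law (i : 'I_n) B : measurable B -> P' (Z i @^-1` B) = P (zeta @^-1` B).
  by move=> mB; rewrite -[LHS]/(distribution P' (Z i) B) -sameZ.
have EB B : measurable B ->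
    P' (E `&` Z k @^-1` B) =
    (\prod_(i < n | i != k) P (zeta @^-1` A i) * P (zeta @^-1` B))%E.
  move=> mB; rewrite independent_extract// law//; congr (_ * _)%E.
  by apply: eq_bigr => i _; rewrite law.
(* Taking B to be the whole line in EB. *)
have PE : P' E = (\prod_(i < n | i != k) P (zeta @^-1` A i))%E.
  have := EB _ measurableT.
  by rewrite !preimage_setT setIT probability_setT mule1.
have -> : \bigcap_(i in [set: 'I_n]) (Z i @^-1` A i) = E `&` Z k @^-1` A k.
  apply/seteqP; split => [w wA|w [wE wk] i _].
    by split=> [i _|]; exact: wA.
  by have [->|ik] := eqVneq i k; [exact: wk|exact: wE].
rewrite -PE -(@integral_law _ _ _ _ _ _ _ zeta (Z k) E (A k) EFin)//.
- by apply: integrableS izeta => //; exact: measurable_RV_preimage.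
- by move=> B mB; rewrite EB// PE.
Qed.

Lemma integrable_copy d (T : measurableType d) d' (T' : measurableType d')
    (R : realType) (P : probability T R) (P' : probability T' R)
    (X : {RV P >-> R}) (Y : {RV P' >-> R}) :
  same_distribution X Y -> P.-integrable [set: T] (EFin \o X) ->
  P'.-integrable [set: T'] (EFin \o Y).
Proof.
move=> sXY /integrableP[_ iX]; apply/integrableP; split.
  exact/measurable_EFinP/measurable_funP.
suff -> : (\int[P']_w `|(EFin \o Y) w| = \int[P]_w `|(EFin \o X) w|)%E by [].
have := @ge0_integral_law _ _ _ _ _ P P' X Y setT setT (abse \o EFin).
rewrite setTI !preimage_setT probability_setT mul1e; apply => //.
- exact: measurableT_comp.
- by move=> x; exact: abse_ge0.
- by move=> B mB; rewrite setTI mul1e -[LHS]/(distribution P' Y B) -sXY.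
Qed.

Lemma integral_cond_expectation d (T : measurableType d) (R : realType)
    (P : probability T R) (X : {RV P >-> R}) (A : set T) :
  P.-integrable [set: T] (EFin \o X) -> measurable A -> P A != 0%E ->
  (\int[P]_(w in A) (X w)%:E)%E = (fine (P A) * cond_expectation X A)%:E.
Proof.
move=> iX mA PA0; rewrite /cond_expectation mulrC divfK; last first.
  by rewrite fine_eq0// fin_num_measure.
rewrite fineK//; apply: (@integrable_fin_num _ _ _ P A _ (EFin \o X)) => //.
exact: integrableS iX.
Qed.

Lemma cond_expectation_le0 d (T : measurableType d) (R : realType)
    (P : probability T R) (X : {RV P >-> R}) (A : set T) :
  (forall w, A w -> X w <= 0) -> cond_expectation X A <= 0.
Proof.
move=> X0; rewrite /cond_expectation mulr_le0_ge0// ?invr_ge0 ?fine_ge0//.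
have NX0 w : A w -> (0 <= (- X w)%:E)%E by move=> /X0; rewrite lee_fin oppr_ge0.
rewrite /Rintegral fine_le0//.
rewrite (@eq_integral _ _ _ _ _ (fun w => - (- X w)%:E)%E).
  by rewrite integral_ge0N// oppe_le0 integral_ge0.
by move=> w _; rewrite EFinN oppeK.
Qed.

(** * Sign patterns *)

(** Indexing the two half-lines by a Boolean makes the sign pattern of a sample,
    a subset S of the indices, a rectangle with sides [sign_set R (i \in S)]. *)
Definition sign_set (R : realType) (b : bool) : set R := [set x | (0 < x) = b].
Arguments sign_set : clear implicits.

Lemma measurable_sign_set (R : realType) (b : bool) : measurable (sign_set R b).
Proof.
have -> : sign_set R b = [set` if b then `]0, +oo[ else `]-oo, 0]].
  apply/seteqP; rewrite /sign_set.
  by case: b; split => x /=; rewrite in_itv/= ?andbT; case: ltP.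
exact: measurable_itv.
Qed.
Arguments measurable_sign_set : clear implicits.

Lemma probability_sign d (T : measurableType d) (R : realType)
    (P : probability T R) (X : {RV P >-> R}) (b : bool) :
  let p := fine (P [set w | 0 < X w]) in
  P (X @^-1` sign_set R b) = (if b then p else 1 - p)%:E.
Proof.
have mX : measurable [set w | 0 < X w].
  exact: (measurable_RV_preimage X (measurable_sign_set R true)).
move=> p; have pE : p%:E = P [set w | 0 < X w].
  by rewrite fineK ?fin_num_measure.
case: b; first exact: esym pE.
rewrite EFinB pE -probability_setC//; congr (P _).
apply/seteqP; split => w; rewrite /sign_set /=; first by move=> ->.
by move/negP/negbTE.
Qed.

(** The number of positive entries is constant on each sign pattern, so the vote
    merely selects patterns. *)
Lemma voting_sum_sign_patterns (T : Type) (R : realType) (n n0 : nat)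
    (Z : 'I_n -> T -> R) (k : 'I_n) (w : T) :
  (Z k w * voting_indicator (fun i => Z i w) n0)%:E =
  (\sum_(S : {set 'I_n} | (n0 < #|S|)%N)
    ((EFin \o Z k) \_
      (\bigcap_(i in [set: 'I_n]) (Z i @^-1` sign_set R (i \in S))) w))%E.
Proof.
(* S0 is the only sign pattern realised at w. *)
pose S0 := [set i : 'I_n | 0 < Z i w]%SET.
have wS (S : {set 'I_n}) : (w \in \bigcap_(i in [set: 'I_n])
    (Z i @^-1` sign_set R (i \in S))) = (S == S0).
  apply/idP/eqP => [/set_mem wS|->].
    by apply/setP => i; rewrite inE -(wS i).
  by apply/mem_set => i _ /=; rewrite inE.
have cS0 : #|[pred i | (0 < Z i w)%R]| = #|S0|.
  by apply: eq_card => i; rewrite !inE.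
under eq_bigr do rewrite patchE wS.
rewrite /voting_indicator cS0 -big_mkcondr/=; case: ltnP => n0S.
  rewrite mulr1 (big_pred1 S0)// => S /=.
  by case: eqVneq => [->|]; rewrite ?n0S ?andbF.
rewrite mulr0 big_pred0// => S.
by case: eqVneq => [->|]; rewrite ?andbF// ltnNge n0S.
Qed.

Lemma voting_sample_expectation_sum d (T : measurableType d) d'
    (T' : measurableType d') (R : realType) (P : probability T R)
    (P' : probability T' R) (zeta : {RV P >-> R}) (n n0 : nat)
    (eta : 'I_n -> T' -> R) (k : 'I_n) :
  P.-integrable [set: T] (EFin \o zeta) -> voting_sample P' zeta n0 eta ->
  let p := fine (P [set w | 0 < zeta w]) in
  ('E_P'[eta k] =
  \sum_(S : {set 'I_n} | (n0 < #|S|)%N)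
    ((\prod_(i < n | i != k) (if i \in S then p else 1 - p))%:E *
    \int[P]_(w in zeta @^-1` sign_set R (k \in S)) (zeta w)%:E))%E.
Proof.
move=> izeta [Z copZ etaE] p.
have mS := measurable_sign_set R.
pose A (S : {set 'I_n}) :=
  \bigcap_(i in [set: 'I_n]) (Z i @^-1` sign_set R (i \in S)).
have mA S : measurable (A S).
  apply: fin_bigcap_measurable => [|i _]; first exact: finite_finset.
  exact: measurable_RV_preimage.
have iZ S : P'.-integrable setT ((EFin \o Z k) \_ (A S)).
  apply: (iffLR (integrable_mkcond _ (mA S))).
  apply: (@integrableS _ _ _ _ setT) => //.
  exact: (integrable_copy (copZ.2 k) izeta).
rewrite unlock (@eq_integral _ _ _ _ _
  (fun w => \sum_(S : {set 'I_n} | (n0 < #|S|)%N)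
    ((EFin \o Z k) \_ (A S)) w)%E); last first.
  by move=> w _; rewrite etaE (voting_sum_sign_patterns n0 (fun i => Z i)).
rewrite (@integral_sum _ _ _ P' setT measurableT _
  (fun S => (EFin \o Z k) \_ (A S)) iZ).
apply: eq_bigr => S _; rewrite -integral_mkcond.
rewrite (@integral_rectangle _ _ _ _ _ _ _ zeta _ Z k
  (fun i => sign_set R (i \in S)))//.
rewrite -prodEFin; congr (_ * _)%E.
by apply: eq_bigr => i _; rewrite probability_sign.
Qed.

Unset Implicit Arguments.
Set Strict Implicit.

(** * The expectation of a voting sample *)

Theorem theorem3 (R : realType)
  (d : measure_display) (T : measurableType d) (P : probability T R)
  (d' : measure_display) (T' : measurableType d') (P' : probability T' R)
  (zeta : {RV P >-> R})
  (zeta_int : P.-integrable [set: T] (EFin \o zeta))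
  (p Em Ep : R)
  (p_def : p = fine (P [set w | 0 < zeta w]))
  (p01 : 0 < p < 1)
  (Em_def : Em = `|cond_expectation zeta [set w | zeta w <= 0]|)
  (Ep_def : Ep = cond_expectation zeta [set w | 0 < zeta w])
  (n n0 : nat) (n_gt0 : (0 < n)%N) (n0_bounds : (1 <= n0 <= n - 1)%N)
  (eta : 'I_n -> T' -> R) (eta_sample : voting_sample P' zeta n0 eta)
  (k : 'I_n) :
  'E_P'[eta k]%E =
  (p * (Ep + Em) * beta_cdf n0 (n - n0) p
   - Em * beta_cdf n0.+1 (n - n0) p)%:E.
Proof.
have [p0 p1] := andP p01.
have EmE : - Em = cond_expectation zeta [set w | zeta w <= 0].
  by rewrite Em_def ler0_norm ?opprK//; exact: cond_expectation_le0.
have sideE b : zeta @^-1` sign_set R b =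
    if b then [set w | 0 < zeta w] else [set w | zeta w <= 0].
  by case: b; apply/seteqP; split => w; rewrite /sign_set/=; case: ltP.
have sideI b : (\int[P]_(w in zeta @^-1` sign_set R b) (zeta w)%:E)%E =
    (if b then p * Ep else (1 - p) * (- Em))%:E.
  have Pb := probability_sign zeta b; rewrite -p_def in Pb.
  rewrite integral_cond_expectation//.
  - by rewrite Pb sideE EmE Ep_def; case: (b).
  - exact: measurable_RV_preimage (measurable_sign_set R b).
  - by rewrite Pb eqe; case: (b); rewrite ?subr_eq0 gt_eqF.
rewrite (voting_sample_expectation_sum k zeta_int eta_sample).
rewrite -p_def; under eq_bigr do rewrite sideI -EFinM prod_sign_pattern.
rewrite sumEFin sum_sign_patterns_binomial_tail; congr (_%:E).
rewrite !beta_cdf_binomial_tail//; [|lia..].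
have -> : (n0 + (n - n0)).-1 = n.-1 by lia.
have -> : (n0.+1 + (n - n0)).-1 = n by lia.
by rewrite opprK mulNr.
Qed.
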